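(* For every mean-payoff game $\mathcal{G}$, every vertex $v$ of $\mathcal{G}$ and every $\epsilon>0$, the value $\mathsf{ASV}^{\epsilon}(v)$ is achievable: there exists a strategy $\sigma_0$ of Player 0 such that for all $\sigma_1\in\mathsf{BR}^{\epsilon}_1(\sigma_0)$, $\underline{\mathsf{MP}}_0(\mathsf{Out}_v(\sigma_0,\sigma_1))\ge\mathsf{ASV}^{\epsilon}(v)$.
   Context: An arena $(V,E,\langle V_0,V_1\rangle,w_0,w_1)$ consists of a finite set $V$ of vertices, a set $E\subseteq V\times V$ of edges such that every vertex has at least one successor, a partition of $V$ into $V_0$ (Player 0) and $V_1$ (Player 1), and weight functions $w_0,w_1:E\to\mathbb{Z}$. A mean-payoff game $\mathcal{G}$ is played on such an arena. A play is an infinite path $\pi=\pi_0\pi_1\dots$; a history is a nonempty finite prefix of a play. The payoff of Player $i\in\{0,1\}$ is $\underline{\mathsf{MP}}_i(\pi)=\liminf_{k\to\infty}\frac1k w_i(\pi_0\dots\pi_k)$, where $w_i$ of a history is the sum of the $w_i$-weights of its edges. A strategy of Player $i$ maps each history ending in a vertex of $V_i$ to a successor of that last vertex; $\Sigma_i$ is the set of strategies of Player $i$. $\mathsf{Out}_v(\sigma_0,\sigma_1)$ is the unique play from $v$ consistent with $\sigma_0$ and $\sigma_1$. For $\epsilon>0$, $\mathsf{BR}^{\epsilon}_{1}(\sigma_0)$ is the set of $\sigma_1\in\Sigma_1$ such that for all $v\in V$ and all $\sigma_1'\in\Sigma_1$: $\underline{\mathsf{MP}}_1(\mathsf{Out}_v(\sigma_0,\sigma_1))>\underline{\mathsf{MP}}_1(\mathsf{Out}_v(\sigma_0,\sigma_1'))-\epsilon$.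 Then $\mathsf{ASV}^{\epsilon}(\sigma_0)(v)=\inf_{\sigma_1\in\mathsf{BR}^{\epsilon}_1(\sigma_0)}\underline{\mathsf{MP}}_0(\mathsf{Out}_v(\sigma_0,\sigma_1))$ and $\mathsf{ASV}^{\epsilon}(v)=\sup_{\sigma_0\in\Sigma_0}\mathsf{ASV}^{\epsilon}(\sigma_0)(v)$. *)

(* Defs.v *)
From mathcomp Require Import all_boot all_order all_algebra.
From mathcomp Require Import boolp classical_sets reals ereal topology normedtype sequences.

Set Implicit Arguments.
Unset Strict Implicit.
Unset Printing Implicit Defensive.

Import Order.TTheory GRing.Theory Num.Theory.
Local Open Scope classical_set_scope.
Local Open Scope ring_scope.

Variant player := Player0 | Player1.

(* The partition of the vertices is given by [owner]: V_i is the set of the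
   vertices v with [owner v = i]; it may be empty.  [weight i] is only ever
   evaluated on edges, so its values on other pairs are irrelevant. *)
Record arena := Arena {
  vertex :> finType;
  edge : rel vertex;
  edge_total : forall v : vertex, exists v' : vertex, edge v v';
  owner : vertex -> player;
  weight : player -> vertex -> vertex -> int }.

Section Game.
Variable G : arena.

Definition is_play (p : nat -> G) : Prop := forall n, edge (p n) (p n.+1).

Definition play_prefix (p : nat -> G) (n : nat) : seq G := mkseq p n.+1.

Definition is_history (h : seq G) : Prop :=
  exists (p : nat -> G) (n : nat), is_play p /\ h = play_prefix p n.

(* Histories are stored as sequences, [x :: h] having last vertex [last x h].
   The underlying function is total; its values on sequences that are not
   histories ending in V_i are unconstrained and never influence an outcome. *)
Record strategy (i : player) := Strategy {
  strategy_fun :> seq G -> G;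
  strategy_edge : forall (x : G) (h : seq G),
    is_history (x :: h) -> owner (last x h) = i ->
    edge (last x h) (strategy_fun (x :: h)) }.

Definition consistent (i : player) (s : strategy i) (p : nat -> G) : Prop :=
  forall n, owner (p n) = i -> p n.+1 = s (play_prefix p n).

Fixpoint outcome_tail (s0 : strategy Player0) (s1 : strategy Player1) (v : G)
    (n : nat) : seq G :=
  if n is m.+1 then
    let t := outcome_tail s0 s1 v m in
    rcons t (match owner (last v t) with
             | Player0 => s0 (v :: t)
             | Player1 => s1 (v :: t)
             end)
  else [::].

(* The unique play from v consistent with both strategies; see [outcomeP]. *)
Definition outcome (s0 : strategy Player0) (s1 : strategy Player1) (v : G)
  (n : nat) : G := last v (outcome_tail s0 s1 v n).

Lemma is_historyP (x : G) (h : seq G) :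
  is_history (x :: h) <-> path (@edge G) x h.
Proof.
split=> [[p [n [pP]]]|].
  rewrite /play_prefix /mkseq /= => -[-> ->].
  elim: n 0%N => //= n IHn k; rewrite pP /=; exact: IHn.
pose nxt (v : G) := xchoose (edge_total v).
have nxtP v : edge v (nxt v) by apply: xchooseP.
pose p n := if (n <= size h)%N then nth x (x :: h) n
            else iter (n - size h) nxt (last x h).
move=> xh; exists p, (size h); split.
  move=> n; rewrite /p; case: (ltngtP n (size h)) => nh.
  - exact: (pathP x xh).
  - by rewrite subSn ?(ltnW nh)//=.
  - by rewrite nh subSnn /= -[size h]/((size (x :: h)).-1) nth_last /=.
apply: (@eq_from_nth _ x) => [|i]; first by rewrite size_mkseq.
by move=> /= ih; rewrite /play_prefix nth_mkseq // /p -ltnS ih.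
Qed.

Lemma outcome_prefix s0 s1 (v : G) n :
  play_prefix (outcome s0 s1 v) n = v :: outcome_tail s0 s1 v n.
Proof.
elim: n => [//|n IHn]; rewrite /play_prefix mkseqS -/(play_prefix _ n) IHn /=.
by rewrite {1}/outcome /= last_rcons.
Qed.

Lemma outcomeP s0 s1 (v : G) (p : nat -> G) :
  [/\ is_play p, p 0%N = v, consistent s0 p & consistent s1 p] <->
  p = outcome s0 s1 v.
Proof.
have outS n : outcome s0 s1 v n.+1 =
    match owner (outcome s0 s1 v n) with
    | Player0 => s0 (play_prefix (outcome s0 s1 v) n)
    | Player1 => s1 (play_prefix (outcome s0 s1 v) n)
    end by rewrite outcome_prefix {1}/outcome /= last_rcons.
split=> [[_ p0 c0 c1]|->].
  suff eqp n : play_prefix p n = play_prefix (outcome s0 s1 v) n.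
    apply/funext => n; have := congr1 (fun s => nth v s n) (eqp n).
    by rewrite !nth_mkseq.
  elim: n => [|n IHn]; first by rewrite /play_prefix /mkseq /= p0.
  have pn : p n = outcome s0 s1 v n.
    by have := congr1 (fun s => nth v s n) IHn; rewrite !nth_mkseq.
  rewrite /play_prefix mkseqS [in RHS]mkseqS -!/(play_prefix _ n) outS -pn -IHn.
  by case E : (owner (p n)); [rewrite (c0 _ E)|rewrite (c1 _ E)].
split=> //; [|by move=> n E; rewrite outS E|by move=> n E; rewrite outS E].
have tailP n : path (@edge G) v (outcome_tail s0 s1 v n).
  elim: n => //= n IHn; rewrite rcons_path IHn /=.
  by case E : owner; apply: strategy_edge => //; apply/is_historyP.
by move=> n; have := tailP n.+1; rewrite /outcome /= rcons_path last_rcons => /andP[].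
Qed.

Definition prefix_weight (i : player) (p : nat -> G) (k : nat) : int :=
  \sum_(j < k) weight i (p j) (p j.+1).

(* The term k = 0, where [0^-1 = 0], does not affect the limit inferior. *)
Definition mean_payoff (R : realType) (i : player) (p : nat -> G) : \bar R :=
  limn_einf (fun k : nat => (k%:R^-1 * (prefix_weight i p k)%:~R)%:E).

Section AdversarialValue.
Context {R : realType}.
Local Open Scope ereal_scope.

Definition BR (eps : R) (s0 : strategy Player0) : set (strategy Player1) :=
  [set s1 | forall (v : G) (s1' : strategy Player1),
     mean_payoff R Player1 (outcome s0 s1 v) >
     mean_payoff R Player1 (outcome s0 s1' v) - eps%:E].

Definition ASV_strategy (eps : R) (s0 : strategy Player0) (v : G) : \bar R :=
  ereal_inf [set mean_payoff R Player0 (outcome s0 s1 v) | s1 in BR eps s0].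

Definition ASV (eps : R) (v : G) : \bar R :=
  ereal_sup [set ASV_strategy eps s0 v | s0 in [set: strategy Player0]].

End AdversarialValue.
End Game.

(* Main.v *)
(** Write [c] for the value [ASV eps v].  A strategy of value more than [c - e]
    has a near-optimal play, of Player 1 payoff [d] say, such that from each of its
    vertices Player 0 can ensure that her payoff is more than [c - e] or that of
    Player 1 is at most [d - eps].  Player 1 refutes such a guarantee by keeping
    two energies bounded below.  Two such energy strategies can be interleaved by
    adding their credits, so Player 0 may punish positionally.  Hence the
    punishments, the vertices of the play and a vertex that it visits infinitely
    often range over a finite set: they can be taken constant along a sequence
    [e -> 0] with [d] convergent.  A fixed punishment then works for the limit
    pair of thresholds, since a play beating a positional punishment contains a
    cycle that beats it with a margin.  Concatenating cycles whose average payoffs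
    tend to [(c, d)] gives a play with payoffs at least [(c, d)]; Player 0 follows
    it and punishes the first deviation. *)

Require Import Defs.
From mathcomp Require Import all_boot all_order all_algebra.
From mathcomp Require Import boolp classical_sets reals ereal topology normedtype sequences.
From mathcomp Require Import ring lra zify.
Import Order.TTheory GRing.Theory Num.Theory.
Local Open Scope ring_scope.

Set Implicit Arguments.
Unset Strict Implicit.

(** * Mean payoffs *)

Lemma le_limn_einfP (R : realType) (u : nat -> \bar R) (x : R) :
  (x%:E <= limn_einf u)%E <->
  forall e : R, 0 < e -> exists N, forall k, (N <= k)%N -> ((x - e)%:E <= u k)%E.
Proof.
rewrite limn_einf_lim (cvg_lim _ (@cvg_einfs_sup R u)) //; split=> [xu e e0|xu].
  have /ereal_sup_gt[_ [N _ <-] xN] : ((x - e)%:E < ereal_sup (range (einfs u)))%E.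
    by apply: lt_le_trans xu; rewrite lte_fin ltrBlDr ltrDl.
  exists N => k Nk; apply: (le_trans (ltW xN)); apply: ereal_inf_lbound.
  by exists k.
apply/lee_addgt0Pr => e e0; have [N uN] := xu _ e0.
rewrite -leeBlDr // -EFinB; apply: (@le_trans _ _ (einfs u N)).
  by apply: le_ereal_inf_tmp => _ [k /= Nk <-]; exact: uN.
by apply: ereal_sup_ubound; exists N.
Qed.

Lemma archi_bound (R : realType) (x e : R) : 0 < e ->
  exists N, forall k, (N <= k)%N -> x <= e * k%:R.
Proof.
move=> e0; exists (Num.bound `|x / e|) => k.
rewrite -(ler_nat R) => Nk; rewrite mulrC -ler_pdivrMr //.
by apply: le_trans Nk; apply: (le_trans (ler_norm _)); exact/ltW/archi_boundP.
Qed.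

Section Payoff.
Variables (R : realType) (G : arena).

Definition psum (f : G -> G -> R) (p : nat -> G) (k : nat) : R :=
  \sum_(j < k) f (p j) (p j.+1).

Lemma psum0 f p : psum f p 0 = 0. Proof. exact: big_ord0. Qed.

Lemma psumS f p k : psum f p k.+1 = psum f p k + f (p k) (p k.+1).
Proof. exact: big_ord_recr. Qed.

Lemma psum_subr f a p k :
  psum (fun x y => f x y - a) p k = psum f p k - a * k%:R.
Proof. by rewrite /psum sumrB sumr_const card_ord mulr_natr. Qed.

Definition shift (n : nat) (p : nat -> G) : nat -> G := fun k => p (n + k)%N.

Lemma psum_shift f p n k : psum f p (n + k) = psum f p n + psum f (shift n p) k.
Proof.
elim: k => [|k IHk]; first by rewrite addn0 psum0 addr0.
by rewrite addnS !psumS IHk addrA /shift addnS.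
Qed.

Definition rweight (i : player) (x y : G) : R := (weight i x y)%:~R.

Lemma rweight_bounded :
  exists2 M : R, 0 <= M & forall i x y, `|rweight i x y| <= M.
Proof.
pose F i := \sum_(e : G * G) `|rweight i e.1 e.2|.
have F0 i : 0 <= F i by apply: sumr_ge0.
exists (F Player0 + F Player1) => [|i x y]; first by rewrite addr_ge0.
have leF : `|rweight i x y| <= F i.
  by rewrite /F (bigD1 (x, y)) //= lerDl sumr_ge0.
by apply: (le_trans leF); case: i {leF}; rewrite ?lerDl ?lerDr.
Qed.

Lemma psum_norm_le f M p k : (forall x y, `|f x y| <= M) ->
  `|psum f p k| <= M * k%:R.
Proof.
move=> fM; apply: (le_trans (ler_norm_sum _ _ _)).
rewrite mulr_natr -[k in leRHS]card_ord -sumr_const.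
by apply: ler_sum => j _.
Qed.

(** The constant [K] absorbs the finitely many early prefixes, so payoffs become lower bounds on all
    partial sums, as in energy games. *)
Lemma mean_payoff_geP i p (x : R) : (x%:E <= mean_payoff R i p)%E <->
  forall e : R, 0 < e -> exists K, forall k,
    (x - e) * k%:R - K <= psum (rweight i) p k.
Proof.
have [M M0 wM] := rweight_bounded.
have pE k : (prefix_weight i p k)%:~R = psum (rweight i) p k.
  by rewrite /prefix_weight rmorph_sum.
rewrite /mean_payoff le_limn_einfP; split=> H e e0.
  have [N HN] := H _ e0; exists ((`|x - e| + M) * N%:R) => k.
  have [Nk|kN] := leqP N k.
    have [->|k0] := posnP k.
      by rewrite psum0 mulr0 sub0r oppr_le0 mulr_ge0 // addr_ge0.
    have := HN _ Nk; rewrite lee_fin pE mulrC ler_pdivlMr ?ltr0n //.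
    apply: le_trans; rewrite lerBlDr lerDl mulr_ge0 // addr_ge0 //.
  have := psum_norm_le p k (wM i); rewrite ler_norml => /andP[+ _].
  apply: le_trans; rewrite lerBlDr.
  have kN' : k%:R <= N%:R :> R by rewrite ler_nat ltnW.
  have := ler_norm (x - e) ; set A := `|x - e| => xA.
  have A0 : 0 <= A by exact: normr_ge0.
  have k0 : 0 <= k%:R :> R by [].
  have := ler_wpM2r k0 xA; have := ler_wpM2l A0 kN'; have := ler_wpM2l M0 kN'.
  lra.
have e20 : 0 < e / 2 by rewrite divr_gt0.
have [K HK] := H _ e20.
have [N HN] := archi_bound K e20.
exists N.+1 => k Nk; rewrite lee_fin pE mulrC ler_pdivlMr ?ltr0n; last by lia.
have := HK k; have := HN k (ltnW Nk); lra.
Qed.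

Lemma mean_payoff_bounded : exists M : R, forall i (p : nat -> G),
  (- M%:E <= mean_payoff R i p <= M%:E)%E.
Proof.
have [M M0 wM] := rweight_bounded; exists M => i p; apply/andP; split.
  apply/mean_payoff_geP => e e0; exists 0 => k.
  have := psum_norm_le p k (wM i); rewrite ler_norml => /andP[+ _].
  have : 0 <= e * k%:R by rewrite mulr_ge0 // ltW.
  lra.
rewrite leNgt; apply/negP => lt.
have [x Mx xm] : exists2 x : R, M < x & (x%:E <= mean_payoff R i p)%E.
  case: (mean_payoff R i p) lt => [r| |] //.
    by rewrite lte_fin => ?; exists r.
  by exists (M + 1); rewrite ?ltrDl ?leey.
have [|K HK] := ((mean_payoff_geP _ _ _).1 xm ((x - M) / 2)); first lra.
have [|N HN] := @archi_bound R (K + 1) ((x - M) / 2); first lra.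
have := HK N; have := HN N (leqnn N).
have := psum_norm_le p N (wM i); rewrite ler_norml => /andP[_]; lra.
Qed.

Definition mp (i : player) (p : nat -> G) : R := fine (mean_payoff R i p).

Lemma mpE i p : mean_payoff R i p = (mp i p)%:E.
Proof.
have [M /(_ i p)] := mean_payoff_bounded; rewrite /mp.
by case: (mean_payoff R i p) => [r|/andP[]|/andP[]].
Qed.

Lemma mp_bounded : exists M : R, forall i (p : nat -> G), - M <= mp i p <= M.
Proof.
have [M bM] := mean_payoff_bounded; exists M => i p.
by have := bM i p; rewrite mpE !lee_fin.
Qed.

Lemma mp_geP i p x : x <= mp i p <->
  forall e : R, 0 < e -> exists K, forall k,
    (x - e) * k%:R - K <= psum (rweight i) p k.
Proof. by rewrite -mean_payoff_geP mpE lee_fin. Qed.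

Lemma mp_le i p x K : (forall k, psum (rweight i) p k <= x * k%:R + K) ->
  mp i p <= x.
Proof.
move=> px; rewrite leNgt; apply/negP => lt.
have [|L HL] := ((mp_geP i p _).1 (lexx _) ((mp i p - x) / 2)); first lra.
have [|N HN] := @archi_bound R (K + L + 1) ((mp i p - x) / 2); first lra.
have := px N; have := HN N (leqnn N); have := HL N; lra.
Qed.

Lemma mp_shift i p n : mp i (shift n p) = mp i p.
Proof.
have [M M0 wM] := rweight_bounded.
apply/eqP; rewrite eq_le; apply/andP; split; apply/mp_geP => e e0.
  have [K HK] := (mp_geP i (shift n p) _).1 (lexx _) _ e0.
  set m := mp _ _ in HK *.
  exists (K + `|m - e| * n%:R + M * n%:R) => k.
  have [nk|kn] := leqP n k.
    have := HK (k - n)%N; have := psum_shift (rweight i) p n (k - n).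
    rewrite subnKC // natrB // => ->.
    have := psum_norm_le p n (wM i); rewrite ler_norml => /andP[+ _].
    have := ler_wpM2r (ler0n R n) (ler_norm (m - e)).
    lra.
  have := psum_norm_le p k (wM i); rewrite ler_norml => /andP[+ _].
  have kn' : k%:R <= n%:R :> R by rewrite ler_nat ltnW.
  have := ler_wpM2r (ler0n R k) (ler_norm (m - e)).
  have := ler_wpM2l (normr_ge0 (m - e)) kn'; have := ler_wpM2l M0 kn'.
  have := HK 0%N; rewrite psum0.
  lra.
have [K HK] := (mp_geP i p _).1 (lexx _) _ e0.
set m := mp _ _ in HK *.
exists (K + `|m - e| * n%:R + M * n%:R) => k.
have := HK (n + k)%N; rewrite psum_shift natrD.
have := psum_norm_le p n (wM i); rewrite ler_norml => /andP[_].
have := ler_wpM2r (ler0n R n) (ler_norm (- (m - e))); rewrite normrN.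
lra.
Qed.

End Payoff.

(** * Energy games and positional punishment *)

Section EnergyGame.
Variables (R : realType) (G : arena) (f g : G -> G -> R).

(** A coinductive winning region of Player 1 in a two-dimensional energy game: positions carry both
    current credits, so no strategies or plays are mentioned. *)
Definition energy_region (E : rel G) (W : G -> R -> R -> Prop) : Prop :=
  forall y a b, W y a b -> [/\ 0 <= a, 0 <= b &
    match owner y with
    | Player0 => forall z, E y z -> W z (a + f y z) (b + g y z)
    | Player1 => exists2 z, E y z & W z (a + f y z) (b + g y z)
    end].

Definition energy_wins (E : rel G) (u : G) : Prop :=
  exists2 W, energy_region E W & exists a b, W u a b.

(** A region for [E1] cannot contain [x] with any credits, and [E] agrees with [E1] elsewhere, so
    the same region serves for [E]. *)
Lemma energy_wins_avoid (E E1 : rel G) (x u : G) :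
  (forall y z, y != x -> E1 y z = E y z) ->
  ~ energy_wins E1 x -> energy_wins E1 u -> energy_wins E u.
Proof.
move=> E1E Nx [W W1 Wu]; exists W => // y a b Wy.
have yx : y != x.
  by apply/eqP => yx; apply: Nx; exists W => //; exists a, b; rewrite -yx.
have [a0 b0 Wn] := W1 _ _ _ Wy; split=> //.
case: (owner y) Wn => [Wz z Ez|[z Ez Wz]]; first by apply: Wz; rewrite E1E.
by exists z => //; rewrite -E1E.
Qed.

(* Player 1 plays both games at once, with the sum of the two credits: the game
   that Player 0 is not playing waits at [x]. *)
Lemma energy_wins_split (E E1 E2 : rel G) (x u : G) :
  owner x = Player0 ->
  (forall y z, y != x -> E1 y z = E y z) ->
  (forall y z, y != x -> E2 y z = E y z) ->
  (forall z, E x z -> E1 x z \/ E2 x z) ->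
  energy_wins E1 u -> energy_wins E2 u -> energy_wins E u.
Proof.
move=> ox E1E E2E Ex w1 w2.
have [x1|x1] := pselect (energy_wins E1 x);
  last exact: (energy_wins_avoid E1E x1 w1).
have [x2|x2] := pselect (energy_wins E2 x);
  last exact: (energy_wins_avoid E2E x2 w2).
case: w1 x2 {x1 w2} => W1 W1P [a1 [b1 W1u]] [W2 W2P [a2 [b2 W2x]]].
pose W y a b := exists c1 d1 c2 d2, [/\ a = c1 + c2, b = d1 + d2 &
  W1 y c1 d1 /\ W2 x c2 d2 \/ W1 x c1 d1 /\ W2 y c2 d2].
exists W; last by exists (a1 + a2), (b1 + b2), a1, b1, a2, b2; split=> //; left.
move=> y a b [c1 [d1 [c2 [d2 [-> ->]]]]].
have W1l z c d e : W1 z (c1 + c) (d1 + d) -> W2 x c2 d2 ->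
    e = d1 + d2 + d -> W z (c1 + c2 + c) e.
  move=> ? ? ->; exists (c1 + c), (d1 + d), c2, d2.
  by split; [ring|ring|left].
have W2r z c d e : W1 x c1 d1 -> W2 z (c2 + c) (d2 + d) ->
    e = d1 + d2 + d -> W z (c1 + c2 + c) e.
  move=> ? ? ->; exists c1, d1, (c2 + c), (d2 + d).
  by split; [ring|ring|right].
(* Here both games are at [x], so the edge taken by Player 0 may decide which of them advances. *)
have [{y}->|yx] := eqVneq y x.
  move=> H; have [{H} W1x {}W2x] : W1 x c1 d1 /\ W2 x c2 d2 by case: H.
  have [c10 d10] := W1P _ _ _ W1x; rewrite ox => W1n.
  have [c20 d20] := W2P _ _ _ W2x; rewrite ox => W2n.
  split; rewrite ?addr_ge0 // => z /Ex[E1z|E2z].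
    by apply: (W1l z _ (g x z)) => //; exact: W1n.
  by apply: (W2r z _ (g x z)) => //; exact: W2n.
case=> -[W1y W2y].
  have [c10 d10 W1n] := W1P _ _ _ W1y; have [c20 d20 _] := W2P _ _ _ W2y.
  split; rewrite ?addr_ge0 //; case: (owner y) W1n => [Wz z Ez|[z Ez Wz]].
    by apply: (W1l z _ (g y z)) => //; apply: Wz; rewrite E1E.
  by exists z; [rewrite -E1E|apply: (W1l z _ (g y z))].
have [c10 d10 _] := W1P _ _ _ W1y; have [c20 d20 W2n] := W2P _ _ _ W2y.
split; rewrite ?addr_ge0 //; case: (owner y) W2n => [Wz z Ez|[z Ez Wz]].
  by apply: (W2r z _ (g y z)) => //; apply: Wz; rewrite E2E.
by exists z; [rewrite -E2E|apply: (W2r z _ (g y z))].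
Qed.

Definition follow (tau : G -> G) : rel G := fun y z =>
  if owner y is Player0 then z == tau y else edge y z.

(** Induction on the number of edges: if Player 0 has two edges at [x], either one of them is
    removed or it is the only one kept there. By [energy_wins_split], Player 1 fails in one of these
    games. Once no choice is left, the remaining edges define [tau]. *)
Lemma energy_positional (u : G) : ~ energy_wins (@edge G) u ->
  exists2 tau : {ffun G -> G}, forall y, edge y (tau y) &
    ~ energy_wins (follow tau) u.
Proof.
suff IH n (F : {set G * G}) : (#|F| <= n)%N ->
    (forall y z, (y, z) \in F -> edge y z) ->
    (forall y z, owner y = Player1 -> edge y z -> (y, z) \in F) ->
    (forall y, exists z, (y, z) \in F) ->
    ~ energy_wins (fun y z => (y, z) \in F) u ->
    exists2 tau : {ffun G -> G}, forall y, edge y (tau y) &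
      ~ energy_wins (follow tau) u.
  move=> Nu; apply: (IH _ [set e | edge e.1 e.2] (leqnn _)).
  - by move=> y z; rewrite inE.
  - by move=> y z; rewrite inE.
  - by move=> y; have [z yz] := edge_total y; exists z; rewrite inE.
  - by under eq_fun do under eq_fun do rewrite inE.
elim: n F => [|n IHn] F.
  rewrite leqn0 cards_eq0 => /eqP F0 _ _ /(_ u)[z]; by rewrite F0 inE.
move=> Fn FE EF Fex NF.
have [[x [z1 [z2 [ox xz1 xz2 z12]]]]|Ffun] := pselect (exists x z1 z2,
    [/\ owner x = Player0, (x, z1) \in F, (x, z2) \in F & z1 != z2]).
  pose F1 := F :\ (x, z1).
  pose F2 := [set e in F | (e.1 == x) ==> (e.2 == z1)].
  have F1n : (#|F1| <= n)%N by move: Fn; rewrite (cardsD1 (x, z1)) xz1.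
  have F2n : (#|F2| <= n)%N.
    rewrite -ltnS; apply: leq_trans Fn; apply: proper_card; apply/properP; split.
      by apply/fintype.subsetP => e; rewrite inE => /andP[].
    by exists (x, z2) => //; rewrite inE /= eqxx xz2 eq_sym.
  have F1E y z : y != x -> ((y, z) \in F1) = ((y, z) \in F).
    by move=> yx; rewrite !inE xpair_eqE (negbTE yx).
  have F2E y z : y != x -> ((y, z) \in F2) = ((y, z) \in F).
    by move=> yx; rewrite !inE /= (negbTE yx) andbT.
  have P1x y : owner y = Player1 -> y != x.
    by move=> oy; apply/eqP => yx; move: oy; rewrite yx ox.
  have [N1|N1] := pselect (energy_wins (fun y z => (y, z) \in F1) u); last first.
    apply: (IHn F1) => //.
    - by move=> y z; rewrite inE => /andP[_]; exact: FE.
    - by move=> y z oy yz; rewrite F1E ?P1x //; exact: EF.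
    - move=> y; have [->|yx] := eqVneq y x.
        by exists z2; rewrite !inE xz2 xpair_eqE eqxx /= eq_sym z12.
      by have [z yz] := Fex y; exists z; rewrite F1E.
  have [N2|N2] := pselect (energy_wins (fun y z => (y, z) \in F2) u); last first.
    apply: (IHn F2) => //.
    - by move=> y z; rewrite inE => /andP[+ _]; exact: FE.
    - by move=> y z oy yz; rewrite F2E ?P1x //; exact: EF.
    - move=> y; have [->|yx] := eqVneq y x.
        by exists z1; rewrite !inE xz1 /= !eqxx.
      by have [z yz] := Fex y; exists z; rewrite F2E.
  case: NF; apply: (energy_wins_split ox F1E F2E _ N1 N2) => z xz.
  have [->|zz1] := eqVneq z z1; [right|left]; rewrite !inE /= ?xz1 ?eqxx //.
  by rewrite xpair_eqE (negbTE zz1) andbF xz.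
have [tau tauP] := choice Fex.
exists (finfun tau); first by move=> y; rewrite ffunE; exact: FE.
case=> W WP Wu; apply: NF; exists W => // y a b /WP[a0 b0].
rewrite /follow; case oy : (owner y); [move=> Wz|move=> [z yz Wz]]; split=> //.
  move=> z yz; apply: Wz; rewrite ffunE; apply: contrapT => /negP ztau.
  by apply: Ffun; exists y, z, (tau y).
by exists z => //; exact: EF.
Qed.

End EnergyGame.

(** * Cycles *)

(** If every [t] failed at some index, directedness would give one index at which all of them fail.
    The indices will be late times or small tolerances. *)
Lemma directed_pigeonhole (I : Type) (T : finType) (P : I -> T -> Prop) :
  inhabited I -> (forall i j, exists k, forall t, P k t -> P i t /\ P j t) ->
  (forall i, exists t, P i t) -> exists t, forall i, P i t.
Proof.
move=> [i0] dirP exP; apply: contrapT => NP.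
have {}NP t : exists i, ~ P i t.
  apply: contrapT => Nt; apply: NP; exists t => i.
  by apply: contrapT => Pit; apply: Nt; exists i.
have [i /= Ni] : exists i, forall t, t \in enum T -> ~ P i t.
  elim: (enum T) => [|t s [i IHi]]; first by exists i0.
  have [j Nj] := NP t; have [k Pk] := dirP i j; exists k => t'.
  by rewrite inE => /orP[/eqP ->|/IHi Ni] /Pk[].
have [t Pit] := exP i; exact: (Ni t (mem_enum T t)).
Qed.

Section Cycles.
Variables (R : realType) (G : arena).
Implicit Types (f g : G -> G -> R) (p : nat -> G).

(** A limit inferior bounds [f] only at arbitrarily late times, so the repeated vertex is chosen
    among those. A late enough visit then exceeds the first one in both sums. *)
Lemma positive_cycle f g p (e C : R) : 0 < e ->
  (forall N, exists2 k, (N <= k)%N & e * k%:R - C <= psum f p k) ->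
  (forall k, e * k%:R - C <= psum g p k) ->
  exists m n, [/\ (m < n)%N, p m = p n,
    psum f p m < psum f p n & psum g p m < psum g p n].
Proof.
move=> e0 fP gP.
have [|||y yP] := @directed_pigeonhole nat G (fun N y => exists k,
    [/\ (N <= k)%N, e * k%:R - C <= psum f p k & p k = y]).
- exact: (inhabits 0%N).
- move=> i j; exists (maxn i j) => y [k [+ fk pk]]; rewrite geq_max => /andP[].
  by move=> ik jk; split; exists k.
- by move=> N; have [k Nk fk] := fP N; exists (p k), k.
have [m [_ _ pm]] := yP 0%N.
have [Nf fN] := archi_bound (psum f p m + C + 1) e0.
have [Ng gN] := archi_bound (psum g p m + C + 1) e0.
have [n [+ fn pn]] := yP (maxn m.+1 (maxn Nf Ng)).
rewrite !geq_max => /and3P[mn /fN fn' /gN gn']; exists m, n.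
have := gP n; split; rewrite ?pm ?pn //; lra.
Qed.

(** Player 1 repeats the cycle forever, Player 0 having no choice in [E]. Credit [K] covers all
    prefix sums before [n], and a round does not lower the credits. *)
Lemma cycle_energy_wins (E : rel G) f g p m n :
  (forall k, E (p k) (p k.+1)) ->
  (forall x y z, owner x = Player0 -> E x y -> E x z -> y = z) ->
  (m < n)%N -> p m = p n ->
  psum f p m <= psum f p n -> psum g p m <= psum g p n ->
  energy_wins f g E (p 0).
Proof.
move=> Ep Efun mn pmn fmn gmn.
pose K := \sum_(j < n) (`|psum f p j| + `|psum g p j|).
have KP j : (j < n)%N -> 0 <= K + psum f p j /\ 0 <= K + psum g p j.
  move=> jn; have : `|psum f p j| + `|psum g p j| <= K.
    rewrite /K (bigD1 (Ordinal jn)) //= lerDl.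
    by apply: sumr_ge0 => i _; rewrite addr_ge0.
  have := lerNnormlW (lexx `|psum f p j|).
  have := lerNnormlW (lexx `|psum g p j|).
  have := normr_ge0 (psum f p j); have := normr_ge0 (psum g p j).
  by split; lra.
exists (fun y a b => exists j,
  [/\ (j < n)%N, y = p j, K + psum f p j <= a & K + psum g p j <= b]); last first.
  by exists K, K, 0%N; rewrite !psum0 addr0; split => //; exact: leq_trans mn.
move=> y a b [j [jn -> ja jb]].
have [fj gj] := KP j jn.
have next : exists i, [/\ (i < n)%N, p j.+1 = p i,
    K + psum f p i <= a + f (p j) (p j.+1) &
    K + psum g p i <= b + g (p j) (p j.+1)].
  have := psumS f p j; have := psumS g p j.
  have [jn'|nj] := ltnP j.+1 n => gS fS.
    by exists j.+1; split=> //; lra.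
  have jE : j.+1 = n by apply/eqP; rewrite eqn_leq jn.
  by move: fS gS; rewrite jE => fS gS; exists m; split=> //; lra.
split; [lra|lra|case oj: (owner (p j))]; last by exists (p j.+1).
by move=> z /(Efun _ _ _ oj (Ep j)) <-.
Qed.

(** Keeping the sums of [below c] and [above d] bounded below forces payoff at most [c] for Player 0
    and at least [d] for Player 1. *)
Definition below (c : R) : G -> G -> R := fun x y => c - rweight R Player0 x y.
Definition above (d : R) : G -> G -> R := fun x y => rweight R Player1 x y - d.

Lemma psum_below c p k :
  psum (below c) p k = c * k%:R - psum (rweight R Player0) p k.
Proof. by rewrite /psum sumrB sumr_const card_ord mulr_natr. Qed.

Lemma psum_above d p k :
  psum (above d) p k = psum (rweight R Player1) p k - d * k%:R.
Proof. exact: psum_subr. Qed.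

Lemma follow_play_wins (tau : G -> G) p (c d : R) :
  (forall k, follow tau (p k) (p k.+1)) ->
  mp R Player0 p < c -> d < mp R Player1 p ->
  exists2 e, 0 < e & forall c' d', c - e <= c' -> d' <= d + e ->
    energy_wins (below c') (above d') (follow tau) (p 0).
Proof.
move=> ptau pc pd.
(* The midpoints are at least [2 * e] away from both payoff and threshold: one gap yields the cycle,
   the other lets the thresholds move. *)
pose c0 := (mp R Player0 p + c) / 2; pose d0 := (mp R Player1 p + d) / 2.
pose e := Num.min ((c - mp R Player0 p) / 4) ((mp R Player1 p - d) / 4).
have e0 : 0 < e by rewrite lt_min; apply/andP; split; lra.
have [ec ed] : e <= (c - mp R Player0 p) / 4 /\ e <= (mp R Player1 p - d) / 4.
  by split; rewrite ge_min lexx ?orbT.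
have [K KP] := (mp_geP Player1 p _).1 (lexx _) e e0.
have [||m [n [mn pmn fmn gmn]]] := @positive_cycle (below c0) (above d0) p e `|K| e0.
- move=> N; apply: contrapT => H.
  have H' k : (N <= k)%N -> psum (below c0) p k < e * k%:R - `|K|.
    by move=> Nk; rewrite ltNge; apply/negP => le; apply: H; exists k.
  (* If the growth failed from [N] on, the payoff of Player 0 would reach [c0 - e]. *)
  suff : c0 - e <= mp R Player0 p by rewrite /c0; lra.
  rewrite -(mp_shift R _ p N); apply/mp_geP => e1 e10.
  exists (psum (rweight R Player0) p N - (c0 - e) * N%:R) => k.
  have := H' _ (leq_addr k N); rewrite psum_below psum_shift natrD.
  have := normr_ge0 K; have := mulr_ge0 (ltW e10) (ler0n R k); lra.
- move=> k; rewrite psum_above; have := KP k; have := ler_norm K.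
  have := ler_wpM2r (ler0n R k) ed; rewrite /d0; lra.
exists e => // c' d' cc' dd'; apply: (cycle_energy_wins ptau _ mn pmn).
- by rewrite /follow => x y z -> /eqP -> /eqP ->.
- move: fmn; rewrite !psum_below.
  have : m%:R <= n%:R :> R by rewrite ler_nat ltnW.
  have c0c' : 0 <= c' - c0 by rewrite /c0; lra.
  rewrite -subr_ge0 => /(mulr_ge0 c0c'); lra.
- move: gmn; rewrite !psum_above.
  have : m%:R <= n%:R :> R by rewrite ler_nat ltnW.
  have c0c' : 0 <= d0 - d' by rewrite /d0; lra.
  rewrite -subr_ge0 => /(mulr_ge0 c0c'); lra.
Qed.

End Cycles.

(** * Concatenation of loops *)

Section CycleConcatenation.
Variables (R : realType) (G : arena) (y : G).
Variables (q : nat -> nat -> G) (L : nat -> nat).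
Hypothesis q0 : forall s, q s 0%N = y.
Hypothesis qL : forall s, q s (L s) = y.
Hypothesis L_gt0 : forall s, (0 < L s)%N.

(* [(s, j)] stands for position [j] of the loop [q s] entered at time [s]. *)
Fixpoint loop_state (k : nat) : nat * nat :=
  if k is k'.+1 then
    let: (s, j) := loop_state k' in
    if (j.+1 < L s)%N then (s, j.+1) else (k, 0%N)
  else (0%N, 0%N).

Definition loop_play (k : nat) : G := q (loop_state k).1 (loop_state k).2.

Lemma loop_stateP k : let: (s, j) := loop_state k in
  (s + j)%N = k /\ (j < L s)%N.
Proof.
elim: k => [|k] /=; first by rewrite L_gt0.
case: (loop_state k) => s j [sj jL].
by case: ltnP => jL'; split; rewrite ?addn0 ?L_gt0 //; lia.
Qed.

Lemma loop_playS k : let: (s, j) := loop_state k in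
  loop_play k = q s j /\ loop_play k.+1 = q s j.+1.
Proof.
have := loop_stateP k; rewrite /loop_play /=.
case: (loop_state k) => s j [_ jL]; split=> //=.
case: ltnP => // jL'; rewrite /= q0 -(qL s); congr (q s); lia.
Qed.

Lemma loop_psum (f : G -> G -> R) k : let: (s, j) := loop_state k in
  psum f loop_play k = psum f loop_play s + psum f (q s) j.
Proof.
elim: k => [|k]; first by rewrite /= !psum0 addr0.
have := loop_playS k; have := loop_stateP k => /=.
case: (loop_state k) => s j [_ jL] [pk pSk] IHk.
case: ltnP => // jL'; last by rewrite psum0 addr0.
by rewrite !psumS IHk pk pSk addrA.
Qed.

(** Relative to [c - e / 2], late complete loops do not lower the sum, and the loop in progress,
    short compared with its entry time, costs at most [e / 2] per unit of time. *)
Lemma loop_mp_ge i (c : R) :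
  (forall e : R, 0 < e -> exists N, forall s, (N <= s)%N ->
    (c - e) * (L s)%:R <= psum (rweight R i) (q s) (L s) /\
    (L s)%:R <= e * s%:R) ->
  c <= mp R i loop_play.
Proof.
move=> qP; apply/mp_geP => e e0.
pose f (x z : G) := rweight R i x z - (c - e / 2).
have fE p k : psum f p k = psum (rweight R i) p k - (c - e / 2) * k%:R.
  exact: psum_subr.
have [M0 M00 wM0] := rweight_bounded R G.
pose M := M0 + `|c - e / 2| + 1.
have M_gt0 : 0 < M by rewrite ltr_wpDl // addr_ge0.
have fM x z : `|f x z| <= M.
  have := ler_normB (rweight R i x z) (c - e / 2).
  by have := wM0 i x z; rewrite /f /M; lra.
(* The first bound makes late loops nonnegative for [f]; the second gives [M * L s <= e / 2 * s]. *)
clearbody f; pose e1 := Num.min (e / 2) (e / 2 / M).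
have e10 : 0 < e1 by rewrite lt_min !divr_gt0.
have [N NP] := qP e1 e10.
pose B := (\sum_(s < N) (s + L s))%N.
have BP s : (s < N)%N -> (s + L s <= B)%N.
  by move=> sN; rewrite /B (bigD1 (Ordinal sN)) //= leq_addr.
have qf s : (N <= s)%N -> 0 <= psum f (q s) (L s) /\ M * (L s)%:R <= e / 2 * s%:R.
  move=> /NP[fL LM]; split.
    have : e1 <= e / 2 by rewrite ge_min lexx.
    move/(ler_wpM2r (ler0n R (L s))); rewrite fE; lra.
  apply: (le_trans (ler_wpM2l (ltW M_gt0) LM)); rewrite mulrA ler_wpM2r //.
  by rewrite -ler_pdivlMl // mulrC ge_min lexx orbT.
have MB0 : 0 <= M * B%:R by rewrite mulr_ge0 // ltW.
have start k : - (M * B%:R) <= psum f loop_play (loop_state k).1.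
  elim: k => [|k]; first by rewrite psum0 oppr_le0.
  have := loop_psum f k; have := loop_playS k; have := loop_stateP k => /=.
  case: (loop_state k) => s j [sj jL] [pk pSk] pE IHk; case: ltnP => //= jL'.
  have LE : L s = j.+1 by lia.
  have pSE : psum f loop_play k.+1 = psum f loop_play s + psum f (q s) (L s).
    by rewrite LE !psumS pE pk pSk addrA.
  have [sN|Ns] := ltnP s N; last first.
    by have [? _] := qf s Ns; rewrite /= in IHk; lra.
  have := psum_norm_le loop_play k.+1 fM; rewrite ler_norml => /andP[+ _].
  apply: le_trans; rewrite lerN2 ler_pM2l // ler_nat.
  by have := BP s sN; lia.
(* One term pays for the sum at the entry of the current loop, the other for that loop itself if it
   was entered before [N]. *)
exists (M * B%:R + M * B%:R) => k.
have := loop_psum f k; have := start k; have := loop_stateP k.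
case: (loop_state k) => s j [sj jL] /= sB; rewrite fE => pE.
have := psum_norm_le (q s) j fM; rewrite ler_norml => /andP[fj _].
have jk : M * j%:R <= M * B%:R + e / 2 * k%:R.
  have [sN|Ns] := ltnP s N.
    have : M * j%:R <= M * B%:R.
      by rewrite ler_pM2l // ler_nat; have := BP s sN; lia.
    have : 0 <= e / 2 * k%:R by rewrite mulr_ge0 // divr_ge0 // ltW.
    lra.
  have [_] := qf s Ns.
  have : M * j%:R <= M * (L s)%:R by rewrite ler_pM2l // ler_nat ltnW.
  have : e / 2 * s%:R <= e / 2 * k%:R.
    by rewrite ler_pM2l ?divr_gt0 // ler_nat; lia.
  lra.
lra.
Qed.

End CycleConcatenation.

Section CycleLimit.
Variables (R : realType) (G : arena).

Definition good_loop (A : {set G}) (y : G) (c d e : R) (q : nat -> G) (L : nat) :=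
  [/\ is_play q, q 0%N = y, q L = y, (0 < L)%N & forall j, q j \in A] /\
  ((c - e) * L%:R <= psum (rweight R Player0) q L /\
   (d - e) * L%:R <= psum (rweight R Player1) q L).

Lemma good_loopW A y c d e e' q L : e <= e' ->
  good_loop A y c d e q L -> good_loop A y c d e' q L.
Proof.
move=> ee' [H [cL dL]]; split=> //.
by have := ler_wpM2r (ler0n R L) ee'; split; lra.
Qed.

Lemma good_loops_play (A : {set G}) (y : G) (c d : R) :
  (forall e : R, 0 < e -> exists q L, good_loop A y c d e q L) ->
  exists p, [/\ is_play p, p 0%N = y, forall k, p k \in A,
    c <= mp R Player0 p & d <= mp R Player1 p].
Proof.
move=> loops.
have [D DP] : exists D : nat -> (nat -> G) * nat,
    forall n, good_loop A y c d n.+1%:R^-1 (D n).1 (D n).2.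
  suff /choice[D DP] : forall n : nat, exists D : (nat -> G) * nat,
    good_loop A y c d n.+1%:R^-1 D.1 D.2 by exists D.
  by move=> n; have [|q [L H]] := loops n.+1%:R^-1; [|exists (q, L)].
(* The loop entered at time [s] is the best one among those that are short
   compared with [s]. *)
pose N s : 'I_s.+1 := [arg max_(n > ord0 | (n * (D n).2 <= s)%N) (n : nat)]%N.
have NP s : (N s * (D (N s)).2 <= s)%N /\
    forall n, (n <= s)%N -> (n * (D n).2 <= s)%N -> (n <= N s)%N.
  rewrite /N; case: arg_maxnP => [|n nP nmax]; first by rewrite mul0n.
  split=> // m; rewrite -ltnS => ms mP; exact: (nmax (Ordinal ms)).
pose q s := (D (N s)).1; pose L s := (D (N s)).2.
have qP s : good_loop A y c d (N s).+1%:R^-1 (q s) (L s) by exact: DP.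
have q0 s : q s 0%N = y by have [[]] := qP s.
have qL s : q s (L s) = y by have [[]] := qP s.
have L0 s : (0 < L s)%N by have [[]] := qP s.
have late e : 0 < e -> exists n, forall s, (n <= s)%N ->
    good_loop A y c d e (q s) (L s) /\ (L s)%:R <= e * s%:R.
  move=> e0; have [m mP] := archi_bound (1 : R) e0.
  (* Loop [m] is then eligible at time [s], so [m <= N s]; as [1 <= e * m], both the tolerance and
     the relative length are at most [e]. *)
  exists (maxn m (m * (D m).2)) => s; rewrite geq_max => /andP[ms mDs].
  have [NDs /(_ m ms mDs) mN] := NP s.
  have m0 : (0 < m)%N.
    rewrite lt0n; apply/eqP => m0.
    by have := mP 0%N; rewrite m0 mulr0 ler10 => /(_ isT).
  split.
    apply: good_loopW (qP s).
    by rewrite -[leLHS]mul1r ler_pdivrMr //; exact/mP/leqW.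
  have Lm : m%:R * (L s)%:R <= s%:R :> R.
    rewrite -natrM ler_nat; apply: leq_trans NDs.
    by rewrite leq_mul2r mN orbT.
  have := ler_wpM2l (ltW e0) Lm; apply: le_trans; rewrite mulrA.
  by rewrite -[leLHS]mul1r ler_wpM2r // mP.
exists (loop_play q L); split.
- move=> k; have := loop_playS q0 qL L0 k.
  case: (loop_state L k) => s j [-> ->].
  by have [[qs _ _ _ _] _] := qP s; exact: qs.
- exact: q0.
- by move=> k; rewrite /loop_play; have [[_ _ _ _ H] _] := qP (loop_state L k).1.
- apply: (loop_mp_ge q0 qL L0) => e /late[n nP].
  by exists n => s /nP[[_ [? _]]].
- apply: (loop_mp_ge q0 qL L0) => e /late[n nP].
  by exists n => s /nP[[_ [_ ?]]].
Qed.

End CycleLimit.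

(** * Plays and strategies *)

Section Strategies.
Variable G : arena.

Definition consistent_play (s0 : strategy G Player0) (v : G) (p : nat -> G) :=
  [/\ is_play p, p 0%N = v & consistent s0 p].

Lemma play_prefix_cons (p : nat -> G) n :
  exists h, [/\ play_prefix p n = p 0%N :: h, size h = n, last (p 0%N) h = p n &
    forall j, (j <= n)%N -> nth (p 0%N) (p 0%N :: h) j = p j].
Proof.
exists [seq p j | j <- iota 1 n]; split=> //; first by rewrite size_map size_iota.
  rewrite -nth_last size_map size_iota; case: n => // n.
  by rewrite (nth_map 0%N) ?size_iota // nth_iota.
by move=> j jn; rewrite -[_ :: _]/(mkseq p n.+1) nth_mkseq.
Qed.

Lemma play_prefixS (p : nat -> G) n :
  play_prefix p n.+1 = rcons (play_prefix p n) (p n.+1).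
Proof. by rewrite /play_prefix mkseqS. Qed.

(** An arbitrary successor is taken where [Q] cannot be met, so [Q] need only be satisfiable on the
    histories of interest. *)
Lemma strategy_choice (v : G) (i : player) (Q : seq G -> G -> Prop) :
  exists s : strategy G i, forall p n z, edge (p n) z ->
    Q (play_prefix p n) z -> Q (play_prefix p n) (s (play_prefix p n)).
Proof.
have [s sP] : exists s : seq G -> G, forall h, let x := last v h in
    edge x (s h) /\ forall z, edge x z -> Q h z -> Q h (s h).
  suff /choice[s sP] : forall h, exists y, let x := last v h in
    edge x y /\ forall z, edge x z -> Q h z -> Q h y by exists s.
  move=> h /=; have [[z [hz Qz]]|N] :=
      pselect (exists z, edge (last v h) z /\ Q h z).
    by exists z; split.
  have [y hy] := edge_total (last v h); exists y; split=> // z hz Qz.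
  by case: N; exists z.
have s_edge (x : G) (h : seq G) : is_history (x :: h) -> owner (last x h) = i ->
    edge (last x h) (s (x :: h)).
  by move=> _ _; have [] := sP (x :: h).
exists (Strategy s_edge) => p n z pz Qz /=; have [_] := sP (play_prefix p n).
apply; last exact: Qz.
by have [h [hE _ hl _]] := play_prefix_cons p n; rewrite hE /= hl.
Qed.

Lemma outcome_consistent s0 s1 (v : G) : consistent_play s0 v (outcome s0 s1 v).
Proof. by have [] := (outcomeP s0 s1 v _).2 erefl. Qed.

Lemma consistent_play_exists s0 (v : G) : exists p, consistent_play s0 v p.
Proof.
have [s1 _] := @strategy_choice v Player1 (fun _ _ => True).
by exists (outcome s0 s1 v); exact: outcome_consistent.
Qed.

(** Best responses are judged from all vertices, so one strategy must realise a play from each. A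
    history shows its initial vertex and its length, which determine the next move. *)
Lemma outcome_onto s0 (v : G) (P : G -> nat -> G) :
  (forall w, consistent_play s0 w (P w)) ->
  exists s1, forall w, outcome s0 s1 w = P w.
Proof.
move=> PP.
have [s1 s1P] := @strategy_choice v Player1
  (fun h z => z = P (head v h) (size h)).
exists s1 => w; apply/esym/outcomeP; have [Pplay Pw cP] := PP w; split=> // n _.
have := s1P (P w) n _ (Pplay n).
have [h [-> hn _ _]] := play_prefix_cons (P w) n.
by rewrite Pw /= hn => ->.
Qed.

(** Only Player 1 can be the first to leave [pi], so the deviating step itself conforms to [follow]
    and the punishment counts from [pi k]. *)
Lemma follow_deviation (v : G) (pi : nat -> G) (tau : G -> G -> G) :
  is_play pi -> pi 0%N = v -> (forall x y, edge y (tau x y)) ->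
  exists2 s0, consistent_play s0 v pi &
    forall p, consistent_play s0 v p -> p = pi \/
      exists2 k, p k = pi k &
        forall n, follow (tau (pi k)) (p (k + n)%N) (p (k + n).+1).
Proof.
move=> pi_play pi0 tauE.
pose agree (h : seq G) j := nth v h j = pi j.
have [s0 s0P] := @strategy_choice v Player0 (fun h z =>
  ((forall j, (j < size h)%N -> agree h j) -> z = pi (size h)) /\
  (forall k, (forall j, (j <= k)%N -> agree h j) -> (k.+1 < size h)%N ->
     ~ agree h k.+1 -> z = tau (pi k) (last v h))).
have sz (p : nat -> G) n : size (play_prefix p n) = n.+1 by rewrite size_mkseq.
have nthp (p : nat -> G) n j : (j <= n)%N -> nth v (play_prefix p n) j = p j.
  by move=> jn; rewrite nth_mkseq.
exists s0.
  split=> // n _; have [|H _] := s0P pi n (pi n.+1) (pi_play n).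
    by rewrite /agree sz; split=> // k _ kn; rewrite nthp.
  by rewrite H sz // => j jn; rewrite /agree nthp.
move=> p [p_play p0 p_s0].
have [|Npi] := pselect (exists n, p n != pi n); last first.
  by left; apply/funext => n; apply/eqP/negPn/negP => pn; apply: Npi; exists n.
move=> /ex_minnP[[|k] pk kmin]; first by move: pk; rewrite p0 pi0 eqxx.
have pE j : (j <= k)%N -> p j = pi j.
  by move=> jk; apply/eqP/negPn/negP => /kmin; lia.
right; exists k => [|n]; first exact: pE.
rewrite /follow; case o : (owner (p (k + n))); last exact: p_play.
case: n o => [|n] o.
  have ok : owner (p k) = Player0 by rewrite -(addn0 k).
  rewrite addn0; case/eqP: pk; rewrite (p_s0 k ok); have [||H _] := s0P p k (pi k.+1).
  - by rewrite pE.
  - split=> [|k' H kk]; first by rewrite sz.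
    by rewrite /agree nthp; [rewrite pE //|]; rewrite sz in kk; lia.
  - by rewrite H sz // => j jk; rewrite /agree nthp // pE.
rewrite p_s0 //; apply/eqP.
have lastp : last v (play_prefix p (k + n.+1)) = p (k + n.+1)%N.
  by rewrite -nth_last sz nthp.
have [||_ H] := s0P p (k + n.+1)%N (tau (pi k) (p (k + n.+1)%N)).
- exact: tauE.
- split=> [H|k' H kn Nk'].
    by case/eqP: pk; rewrite -(H k.+1) ?nthp ?sz //; lia.
  rewrite sz in kn; rewrite lastp; congr (tau (pi _) _).
  rewrite /agree nthp in Nk'; last by lia.
  have kk' : (k <= k')%N by rewrite leqNgt; apply/negP => /pE.
  apply/eqP; rewrite eqn_leq kk' leqNgt; apply/negP => k'k.
  by case/eqP: pk; rewrite -(H k.+1) ?nthp //; lia.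
rewrite (H k) ?sz ?lastp //; last 1 first.
- by rewrite /agree nthp ?addnS ?ltnS ?leq_addr //; exact/eqP.
- by move=> j jk; rewrite /agree nthp ?pE //; lia.
- by lia.
Qed.

End Strategies.

(** * Best responses and near-optimal plays *)

Section Responses.
Variables (R : realType) (G : arena).

Lemma BR_consistent_play (eps : R) s0 s1 (v : G) p : BR eps s0 s1 ->
  consistent_play s0 v p ->
  mp R Player1 p - eps < mp R Player1 (outcome s0 s1 v).
Proof.
move=> br pP.
have [P PP] := choice (consistent_play_exists s0).
have [|s1' s1'P] := @outcome_onto _ s0 v (fun w => if w == v then p else P w).
  by move=> w; case: eqP => [->|_].
by have := br v s1'; rewrite s1'P eqxx !mpE -EFinB lte_fin.
Qed.

Lemma near_optimal_play (eps : R) s0 (v : G) : 0 < eps ->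
  exists2 p, consistent_play s0 v p & forall p', consistent_play s0 v p' ->
    mp R Player1 p' - eps < mp R Player1 p.
Proof.
move=> eps0; have [p0 p0P] := consistent_play_exists s0 v.
pose S := ([set mp R Player1 p | p in consistent_play s0 v])%classic.
have S0 : has_sup S.
  split; first by exists (mp R Player1 p0), p0.
  have [M MP] := mp_bounded R G; exists M => _ [p _ <-].
  by have /andP[] := MP Player1 p.
have [_ [p pP <-] pS] := sup_adherent eps0 S0.
exists p => // p' p'P; apply: le_lt_trans pS; rewrite lerD2r.
by apply: ub_le_sup; [case: S0|exists p'].
Qed.

(** Since [BR] constrains all initial vertices, [p] is completed by near-optimal plays from the
    other vertices. *)
Lemma near_optimal_play_BR (eps : R) s0 (v : G) p : 0 < eps ->
  consistent_play s0 v p ->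
  (forall p', consistent_play s0 v p' -> mp R Player1 p' - eps < mp R Player1 p) ->
  exists2 s1, BR eps s0 s1 & outcome s0 s1 v = p.
Proof.
move=> eps0 pP popt.
have [P PP] : exists P : G -> nat -> G, forall w, consistent_play s0 w (P w) /\
    forall p', consistent_play s0 w p' -> mp R Player1 p' - eps < mp R Player1 (P w).
  suff /choice[P PP] : forall w, exists p, consistent_play s0 w p /\ forall p',
    consistent_play s0 w p' -> mp R Player1 p' - eps < mp R Player1 p by exists P.
  by move=> w; have [q ? ?] := near_optimal_play s0 w eps0; exists q.
pose P' w := if w == v then p else P w.
have P'P w : consistent_play s0 w (P' w) /\
    forall p', consistent_play s0 w p' -> mp R Player1 p' - eps < mp R Player1 (P' w).
  by rewrite /P'; case: eqP => [->|_] //; exact: PP.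
have [|s1 s1P] := @outcome_onto _ s0 v P'; first by move=> w; have [] := P'P w.
exists s1; last by rewrite s1P /P' eqxx.
move=> w s1'; rewrite s1P !mpE -EFinB lte_fin.
by have [_] := P'P w; apply; exact: outcome_consistent.
Qed.

(** Player 1 follows [p] up to time [k] and then stays in the region, which is closed under every
    move that [s0] may make. *)
Lemma energy_attack (f g : G -> G -> R) s0 (v : G) p k :
  consistent_play s0 v p -> energy_wins f g (@edge G) (p k) ->
  exists2 q, consistent_play s0 v q & exists K, forall n,
    - K <= psum f (shift k q) n /\ - K <= psum g (shift k q) n.
Proof.
move=> [p_play p0 p_s0] [W WP [a [b Wab]]].
pose hsum (e : G -> G -> R) (h : seq G) := psum e (nth v h) (size h).-1.
have hsumE e (q : nat -> G) n : hsum e (play_prefix q n) = psum e q n.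
  rewrite /hsum size_mkseq; apply: eq_bigr => j _.
  by rewrite !nth_mkseq ?ltnS // ltnW.
(* Subtracting the sums of the first [k] steps lets the credits be read off the whole history. *)
pose a1 := a - psum f p k; pose b1 := b - psum g p k.
have [s1 s1P] := @strategy_choice _ v Player1 (fun h z =>
  if (size h <= k)%N then z = p (size h) else
  W z (a1 + hsum f h + f (last v h) z) (b1 + hsum g h + g (last v h) z)).
set q := outcome s0 s1 v.
have [q_play q0 q_s0 q_s1] := (outcomeP s0 s1 v q).2 erefl.
have qp n : (n <= k)%N -> play_prefix q n = play_prefix p n.
  elim: n => [|n IHn] nk; first by rewrite /play_prefix /mkseq /= q0 p0.
  have {}IHn := IHn (ltnW nk); rewrite !play_prefixS IHn; congr rcons.
  have qpn : q n = p n.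
    by have := congr1 (fun h => nth v h n) IHn; rewrite !nth_mkseq.
  case o : (owner (q n)); first by rewrite q_s0 // IHn p_s0 // -qpn.
  rewrite q_s1 // IHn; have := s1P p n _ (p_play n).
  by rewrite size_mkseq nk; apply.
have qpk j : (j <= k)%N -> q j = p j.
  move=> jk; have := congr1 (fun h => nth v h j) (qp k (leqnn k)).
  by rewrite !nth_mkseq.
have psumqp e : psum e q k = psum e p k.
  by apply: eq_bigr => j _; rewrite !qpk // ltnW.
have Wq n : W (q (k + n)%N) (a + psum f (shift k q) n) (b + psum g (shift k q) n).
  elim: n => [|n IHn]; first by rewrite addn0 !psum0 !addr0 qpk.
  have [_ _] := WP _ _ _ IHn; rewrite addnS !psumS /shift addnS !addrA.
  case o : (owner (q (k + n)%N)); first by apply; exact: q_play.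
  move=> [z qz Wz]; rewrite q_s1 //.
  have lastq : last v (play_prefix q (k + n)) = q (k + n)%N.
    by rewrite -nth_last size_mkseq nth_mkseq.
  have aE : a1 + psum f q (k + n) = a + psum f (shift k q) n.
    by rewrite psum_shift psumqp /a1; ring.
  have bE : b1 + psum g q (k + n) = b + psum g (shift k q) n.
    by rewrite psum_shift psumqp /b1; ring.
  have late : (size (play_prefix q (k + n)) <= k)%N = false.
    by rewrite leqNgt size_mkseq ltnS leq_addr.
  by have := s1P q (k + n)%N z qz; rewrite late !hsumE lastq aE bE; apply.
exists q; first by split.
exists (Num.max a b) => n; have [a0 b0 _] := WP _ _ _ (Wq n).
have am : a <= Num.max a b by rewrite le_max lexx.
have bm : b <= Num.max a b by rewrite le_max lexx orbT.
by split; lra.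
Qed.

End Responses.

(** * Passing to the limit *)

(** Bolzano-Weierstrass after fixing [t] by the pigeonhole; [sup S] is the limit superior of the
    admissible [d]. *)
Lemma bounded_limit_point (R : realType) (T : finType) (P : R -> R -> T -> Prop)
    (M : R) :
  (forall (e e' : R) d t, e <= e' -> P e d t -> P e' d t) ->
  (forall e : R, 0 < e -> exists (d : R) t, - M <= d <= M /\ P e d t) ->
  exists (d : R) t, forall e : R, 0 < e -> exists2 d', `|d' - d| <= e & P e d' t.
Proof.
move=> PW exP.
have [|||t tP] := @directed_pigeonhole {e : R | 0 < e} T
    (fun e t => exists2 d, - M <= d <= M & P (sval e) d t).
- by split; exists 1.
- move=> [e e0] [e' e'0].
  have m0 : 0 < Num.min e e' by rewrite lt_min e0.
  exists (exist (fun e : R => 0 < e) _ m0) => t [d dM /= Pd].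
  by split; exists d => //; apply: PW Pd; rewrite ge_min lexx ?orbT.
- by move=> [e e0]; have [d [t [dM Pd]]] := exP e e0; exists t, d.
pose S : set R := fun x => forall e, 0 < e ->
  exists d, [/\ x <= d, - M <= d <= M & P e d t].
have SM : S (- M).
  move=> e e0; have [d dM Pd] := tP (exist (fun e : R => 0 < e) e e0).
  by exists d; split=> //; case/andP: dM.
have supS : has_sup S.
  split; first by exists (- M).
  by exists M => x /(_ 1 ltr01)[d [xd /andP[_ dM] _]]; exact: le_trans dM.
exists (sup S), t => e e0.
have NS : ~ S (sup S + e).
  by move=> /(ub_le_sup supS.2); lra.
(* Tolerance [e1] excludes values from [sup S + e] on, so a witness for the minimum of [e] and [e1]
   is close from both sides. *)
have [e1 [e10 Ne1]] : exists e1, 0 < e1 /\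
    forall d, sup S + e <= d -> - M <= d <= M -> ~ P e1 d t.
  apply: contrapT => N; apply: NS => e1 e10; apply: contrapT => N1.
  by apply: N; exists e1; split=> // d Sd dM Pd; apply: N1; exists d.
have [x Sx xS] := sup_adherent e0 supS.
have m0 : 0 < Num.min e e1 by rewrite lt_min e0.
have [d [xd dM Pd]] := Sx _ m0.
have Pe : P e d t by apply: PW Pd; rewrite ge_min lexx.
have Pe1 : P e1 d t by apply: PW Pd; rewrite ge_min lexx orbT.
exists d => //; rewrite ler_norml; apply/andP; split; first lra.
rewrite lerBlDl leNgt; apply/negP => dS.
by apply: (Ne1 d _ dM Pe1); exact: ltW.
Qed.

Lemma energy_winsW (R : realType) (G : arena) (f g f' g' : G -> G -> R) E u :
  (forall x y, f x y <= f' x y) -> (forall x y, g x y <= g' x y) ->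
  energy_wins f g E u -> energy_wins f' g' E u.
Proof.
move=> ff' gg' [W WP [a [b Wab]]].
exists (fun y a b => exists a' b', [/\ a' <= a, b' <= b & W y a' b']); last first.
  by exists a, b, a, b.
move=> y {Wab}a {}b [a' [b' [aa' bb' /WP[a0 b0 Wn]]]].
split; [lra|lra|case: (owner y) Wn => [Wn z yz|[z yz Wz]]].
  exists (a' + f y z), (b' + g y z).
  by split; [exact: lerD|exact: lerD|exact: Wn].
exists z => //; exists (a' + f y z), (b' + g y z).
by split; [exact: lerD|exact: lerD|].
Qed.

Section AchievableValue.
Variables (R : realType) (G : arena) (v : G) (eps : R).
Hypothesis eps_gt0 : 0 < eps.

(** The upper bound rests on the existence of a best response: an infimum over the empty set would
    be infinite. *)
Lemma ASV_fin_num : exists c : R, ASV eps v = c%:E.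
Proof.
have [M MP] := mp_bounded R G.
have [s0 _] := @strategy_choice _ v Player0 (fun _ _ => True).
have ge : ((- M)%:E <= ASV eps v)%E.
  apply: (@le_trans _ _ (ASV_strategy eps s0 v)).
    apply: le_ereal_inf_tmp => _ [s1 _ <-]; rewrite mpE lee_fin.
    by have /andP[] := MP Player0 (outcome s0 s1 v).
  by apply: ereal_sup_ubound; exists s0.
have le : (ASV eps v <= M%:E)%E.
  apply: ge_ereal_sup => _ [s _ <-].
  have [p pP popt] := near_optimal_play s v eps_gt0.
  have [s1 s1P _] := near_optimal_play_BR eps_gt0 pP popt.
  apply: (@le_trans _ _ (mean_payoff R Player0 (outcome s s1 v))).
    by apply: ereal_inf_lbound; exists s1.
  by rewrite mpE lee_fin; have /andP[] := MP Player0 (outcome s s1 v).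
by case: (ASV eps v) ge le => [c| |] //; exists c.
Qed.

Lemma ASV_approx (c e : R) : ASV eps v = c%:E -> 0 < e ->
  exists s0, forall s1, BR eps s0 s1 -> c - e < mp R Player0 (outcome s0 s1 v).
Proof.
move=> cE e0.
have [|_ [s0 _ <-] s0c] := @ub_ereal_sup_adherent R
    [set ASV_strategy eps s0 v | s0 in [set: strategy G Player0]]%classic e e0.
  by rewrite -/(ASV eps v) cE.
exists s0 => s1 s1P; rewrite -lte_fin -mpE EFinB -cE.
by apply: (lt_le_trans s0c); apply: ereal_inf_lbound; exists s1.
Qed.

(* [d] is the payoff of Player 1 on a near-optimal play of a strategy of value
   more than [c - e], [A] the set of vertices of that play, [tau x] a positional
   punishment strategy from [x], and [y] a vertex that the play visits infinitely
   often. *)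
Definition near_witness (c e d : R)
    (t : {set G} * {ffun G -> {ffun G -> G}} * G) : Prop :=
  let: (A, tau, y) := t in
  [/\ forall x z, edge z (tau x z),
      forall x, x \in A -> ~ energy_wins (below (c - e)) (above (d - eps + e))
        (follow (tau x)) x,
      exists p k, [/\ is_play p, p 0%N = v, p k = y & forall j, p j \in A]
    & exists q L, good_loop A y c d e q L].

Lemma near_witnessW (c e e' d : R) t : e <= e' ->
  near_witness c e d t -> near_witness c e' d t.
Proof.
case: t => [[A tau] y] ee' [tauE Atau Ap [q [L loop]]]; split=> //.
  move=> x xA w; apply: (Atau x xA); apply: energy_winsW w => x' y'.
    by rewrite /below; lra.
  by rewrite /above; lra.
by exists q, L; exact: good_loopW loop.
Qed.

Lemma near_witness_exists (c e : R) : ASV eps v = c%:E -> 0 < e ->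
  exists (p : nat -> G) t, near_witness c e (mp R Player1 p) t.
Proof.
move=> cE e0; have [s0 s0P] := ASV_approx cE e0.
have BRc p : consistent_play s0 v p -> (forall p', consistent_play s0 v p' ->
    mp R Player1 p' - eps < mp R Player1 p) -> c - e < mp R Player0 p.
  move=> pP popt; have [s1 s1P <-] := near_optimal_play_BR eps_gt0 pP popt.
  exact: s0P.
(* Optimality within [eps] makes [p] the outcome of a best response; optimality within [e] does so
   for every consistent play giving Player 1 at least [d - eps + e]. *)
have m0 : 0 < Num.min eps e by rewrite lt_min eps_gt0.
have [meps me] : Num.min eps e <= eps /\ Num.min eps e <= e.
  by rewrite !ge_min !lexx orbT.
have [p pP popt] := near_optimal_play s0 v m0.
have cp : c - e < mp R Player0 p by apply: BRc => // p' /popt; lra.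
have [p_play p0 _] := pP; set d := mp R Player1 p in popt *.
pose A := [set x | `[< exists k, p k = x >]].
have pA j : p j \in A by rewrite inE; apply/asboolP; exists j.
(* A win of Player 1 would give such a play with Player 0 payoff at most [c - e], contrary to the
   choice of [s0]. *)
have N x : x \in A ->
    ~ energy_wins (below (c - e)) (above (d - eps + e)) (@edge G) x.
  rewrite inE => /asboolP[k <-] /(energy_attack pP)[q qP [K qK]].
  have q0 : mp R Player0 q <= c - e.
    rewrite -(mp_shift R _ q k); apply: (@mp_le _ _ _ _ _ K) => n.
    by have [+ _] := qK n; rewrite psum_below; lra.
  have q1 : d - eps + e <= mp R Player1 q.
    rewrite -(mp_shift R _ q k); apply/mp_geP => e1 e10; exists K => n.
    have [_] := qK n; rewrite psum_above.
    have := mulr_ge0 (ltW e10) (ler0n R n); lra.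
  have := BRc q qP; rewrite ltNge q0 => H.
  by have : false by apply: H => p' /popt; lra.
have [tau tauP] : exists tau : G -> {ffun G -> G}, forall x,
    (forall z, edge z (tau x z)) /\ (x \in A ->
      ~ energy_wins (below (c - e)) (above (d - eps + e)) (follow (tau x)) x).
  suff /choice[tau tauP] : forall x, exists t : {ffun G -> G},
      (forall z, edge z (t z)) /\ (x \in A ->
      ~ energy_wins (below (c - e)) (above (d - eps + e)) (follow t) x).
    by exists tau.
  move=> x; have [/N/energy_positional[t tE Nt]|_] := boolP (x \in A).
    by exists t.
  have [t tE] := choice (@edge_total G).
  by exists (finfun t); split=> // z; rewrite ffunE.
pose f i a (x z : G) := rweight R i x z - a.
have fE i a q n : psum (f i a) q n = psum (rweight R i) q n - a * n%:R.
  exact: psum_subr.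
(* Half of each slack goes to the approximation of the payoff; the other half makes both sums grow
   at rate at least [h]. *)
pose h := Num.min (mp R Player0 p - (c - e)) e / 2.
have [h0 [hc he]] : 0 < h /\ h <= (mp R Player0 p - (c - e)) / 2 /\ h <= e / 2.
  split; first by rewrite divr_gt0 // lt_min e0 subr_gt0 cp.
  by rewrite !ler_pM2r ?invr_gt0 // !ge_min !lexx orbT.
have [K0 K0P] := (mp_geP Player0 p _).1 (lexx _) h h0.
have [K1 K1P] := (mp_geP Player1 p _).1 (lexx _) h h0.
have [||m [n [mn pmn fmn gmn]]] :=
    @positive_cycle _ _ (f Player0 (c - e)) (f Player1 (d - e)) p h
      (`|K0| + `|K1|) h0.
- move=> k; exists k => //; rewrite fE; have := K0P k.
  have := ler_norm K0; have := normr_ge0 K1.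
  have := ler_wpM2r (ler0n R k) hc; lra.
- move=> k; rewrite fE; have := K1P k; rewrite -/d.
  have := ler_norm K1; have := normr_ge0 K0.
  have := ler_wpM2r (ler0n R k) he; lra.
exists p, (A, finfun tau, p m); split.
- by move=> x z; rewrite ffunE; have [] := tauP x.
- by move=> x xA; rewrite ffunE; have [_] := tauP x; apply.
- by exists p, m.
exists (shift m p), (n - m)%N; split.
  split; rewrite /shift ?addn0 ?subnKC ?subn_gt0 //; last exact: ltnW.
  by move=> k; rewrite addnS; exact: p_play.
have psE i a : psum (f i a) p m < psum (f i a) p n ->
    a * (n - m)%:R <= psum (rweight R i) (shift m p) (n - m).
  have := psum_shift (f i a) p m (n - m).
  by rewrite subnKC ?(ltnW mn) // => ->; rewrite ltrDl fE; lra.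
by split; exact: psE.
Qed.

Lemma near_witness_limit c d t :
  (forall e : R, 0 < e -> exists2 d', `|d' - d| <= e & near_witness c e d' t) ->
  exists s0 : strategy G Player0, forall s1, BR eps s0 s1 ->
    c <= mp R Player0 (outcome s0 s1 v).
Proof.
case: t => [[A tau] y] wit.
have [_ _ [tauE _ [p [k [p_play p0 pk pA]]] _]] := wit 1 ltr01.
have [pi' [pi'_play pi'0 pi'A pi'c pi'd]] : exists p, [/\ is_play p, p 0%N = y,
    forall k, p k \in A, c <= mp R Player0 p & d <= mp R Player1 p].
  apply: good_loops_play => e e0; have e20 : 0 < e / 2 by rewrite divr_gt0.
  have [d' + [_ _ _ [q [L [qL [c_le d_le]]]]]] := wit _ e20.
  rewrite ler_norml => /andP[dd' _]; exists q, L; split=> //; split.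
    by have := ler_wpM2r (ler0n R L) (ltW e20); lra.
  have : d - e <= d' - e / 2 by lra.
  by move/(ler_wpM2r (ler0n R L)); lra.
(* The prefix of [p] leads from [v] to [y], where the loops are based, and does not affect the
   payoffs. *)
pose pi n := if (n < k)%N then p n else pi' (n - k)%N.
have pi_shift : shift k pi = pi'.
  by apply/funext => n; rewrite /shift /pi ltnNge leq_addr /= addKn.
have pi_play : is_play pi.
  move=> n; rewrite /pi; case: (ltngtP n.+1 k) => nk.
  - exact: p_play.
  - by rewrite subSn //; exact: pi'_play.
  - by rewrite nk subnn pi'0 -pk -nk; exact: p_play.
have pi0 : pi 0%N = v.
  by rewrite /pi; case: posnP => // k0; rewrite sub0n pi'0 -pk k0.
have piA n : pi n \in A by rewrite /pi; case: ifP.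
have pi_mp i : mp R i pi = mp R i pi' by rewrite -(mp_shift R i pi k) pi_shift.
have [s0 s0pi s0P] := follow_deviation pi_play pi0 tauE.
exists s0 => s1 s1P; have := outcome_consistent s0 s1 v.
have := BR_consistent_play s1P s0pi; rewrite pi_mp.
set o := outcome _ _ _ => od /s0P[->|[j ojE oj]]; first by rewrite pi_mp.
rewrite leNgt; apply/negP => oc.
(* A deviating best response gives Player 1 more than [d - eps]. If it gave Player 0 less than [c],
   it would beat the punishment with margin [e], hence also at the thresholds of the witness for
   [e / 2]. *)
have [| | |e e0] := @follow_play_wins R _ (tau (pi j)) (shift j o) c (d - eps).
- by move=> n; have := oj n; rewrite /shift addnS.
- by rewrite mp_shift.
- by rewrite mp_shift; lra.
have e20 : 0 < e / 2 by rewrite divr_gt0.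
have [d' + [_ /(_ _ (piA j)) N _ _]] := wit _ e20.
rewrite ler_norml => /andP[_ dd']; rewrite /shift addn0 ojE => H.
by apply: N; apply: H; lra.
Qed.

End AchievableValue.

Theorem theorem31 (R : realType) (G : arena) (v : G) (eps : R) (eps_gt0 : 0 < eps) :
  exists s0 : strategy G Player0,
    forall s1 : strategy G Player1, BR eps s0 s1 ->
      (ASV eps v <= mean_payoff R Player0 (outcome s0 s1 v))%E.
Proof.
have [c cE] := ASV_fin_num v eps_gt0.
have [M MP] := mp_bounded R G.
have [||d [t dtP]] := @bounded_limit_point R _ (near_witness v eps c) M.
- exact: near_witnessW.
- move=> e e0; have [p [t H]] := near_witness_exists eps_gt0 cE e0.
  by exists (mp R Player1 p), t.
have [s0 s0P] := near_witness_limit dtP.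
by exists s0 => s1 /s0P; rewrite cE mpE lee_fin.
Qed.
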